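(* Let $n\ge 2$ be an integer and let $A\subseteq\mathbb{F}_{2^{n-1}}\setminus\{0\}$ with $|A|=k$. Then there exist a subset of $\mathbb{F}_{2^n}\setminus\{0\}$ of size $k$ and a subset of $\mathbb{F}_{2^n}\setminus\{0\}$ of size $k+1$, both of which have $r$-value equal to $r(A)$.
   Context: For a subset $X$ of a finite additive abelian group, the $r$-value $r(X)$ is the number of ordered pairs $(x,y)\in X\times X$ with $x+y\in X$. Only the additive group of $\mathbb{F}_{2^n}$ is used: its elements are written as vectors $[\alpha_1,\dots,\alpha_n]$ with $\alpha_i\in\{0,1\}$ and addition coordinatewise modulo 2. By convention $\mathbb{F}_{2^{n-1}}$ is regarded as the subset of $\mathbb{F}_{2^n}$ consisting of the vectors with first coordinate $\alpha_1=0$. *)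

(* Defs.v *)
From HB Require Import structures.
From mathcomp Require Import all_boot all_order all_algebra.
Set Implicit Arguments.
Unset Strict Implicit.
Unset Printing Implicit Defensive.
Import GRing.Theory.
Local Open Scope ring_scope.

Definition rvalue (V : finZmodType) (X : {set V}) : nat :=
  #|[set p : V * V | [&& p.1 \in X, p.2 \in X & p.1 + p.2 \in X]]|.

(* Only the additive group of the field with 2 ^ n elements matters; coordinates
   are indexed from 0, so that alpha_1 is the entry at index 0. *)
Notation F2n n := 'rV['F_2]_n.

(* The copy of F2n n.-1 inside F2n n. The quantifier over i only serves to name
   index 0 without a proof of 0 < n; for n = 0 it would be vacuous. *)
Definition F2n_pred (n : nat) : {set F2n n} :=
  [set x : F2n n | [forall i : 'I_n, (i == 0 :> nat) ==> (x 0 i == 0)]].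

(* Main.v *)
Require Import Defs.
From HB Require Import structures.
From mathcomp Require Import all_boot all_order all_algebra.
Set Implicit Arguments.
Unset Strict Implicit.
Unset Printing Implicit Defensive.
Import GRing.Theory.
Local Open Scope ring_scope.

(** The set of size [k] is [A] itself. For size [k.+1], adjoin to [A] a vector
    [e] outside the subgroup [F2n_pred n] that contains [A]. Modulo this
    subgroup, [e] has a nonzero class and the elements of [A] have class zero,
    so among the equations [x + y = z] over [e |: A] that involve [e], classes
    leave only those where exactly one summand and the sum are [e], and those
    where both summands are [e]. The former force the other summand to be [0],
    and the latter force the sum to be [0] by characteristic two; but [0] is
    not in [e |: A]. Hence the new element creates no new solution
    ([rvalue_setU1]). *)

(** With [x], [y] in [H], either of [e + x = y] and [x + y = e] would put [e]
    in [H], while [e + x = e] needs [x = 0]. The sum [e + e] is not controlled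
    by the class of [e], which may have order two modulo [H]; hence the
    separate hypothesis on it. *)
Lemma rvalue_setU1 (V : finZmodType) (H X : {set V}) (e : V) :
    zmod_closed H -> X \subset H -> 0 \notin X -> e \notin H ->
    e + e \notin X -> rvalue (e |: X) = rvalue X.
Proof.
move=> [H0 HB] /subsetP XH X0 eH eeX.
have HN x : x \in H -> - x \in H by move=> xH; rewrite -sub0r HB.
have HD x y : x \in H -> y \in H -> x + y \in H.
  by move=> xH yH; rewrite -[y]opprK HB ?HN.
have eX : e \notin X by apply: contra eH; apply: XH.
have e0 : e != 0 by apply: contraNneq eH => ->.
have eDX x : x \in X -> e + x \notin e |: X.
  move=> xX; rewrite !inE negb_or; apply/andP; split.
    by rewrite -subr_eq0 addrC addKr; apply: contraNneq X0 => <-.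
  by apply: contra eH => /XH exH; rewrite -(addrK x e) HB // XH.
rewrite /rvalue; apply: eq_card => -[x y]; rewrite !inE /=.
case: (eqVneq x e) => [->|_]; case: (eqVneq y e) => [->|_] /=.
- rewrite (negPf eX) (negPf eeX) orbF -subr_eq0 addrK.
  exact: negPf.
- rewrite (negPf eX); apply/negP => /andP[yX].
  by have := eDX _ yX; rewrite !inE => /negP.
- rewrite (negPf eX) andbF; apply/negP => /andP[xX].
  by have := eDX _ xX; rewrite !inE addrC => /negP.
- case xX: (x \in X) => //=; case yX: (y \in X) => //=.
  case: eqP => //= xye.
  by move: eH; rewrite -xye HD ?XH.
Qed.

Lemma F2n_pred_zmod_closed n : zmod_closed (F2n_pred n).
Proof.
split=> [|x y]; first by rewrite inE; apply/forallP=> i; rewrite mxE eqxx implybT.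
rewrite !inE => /forallP Hx /forallP Hy; apply/forallP=> i; apply/implyP=> i0.
have /eqP xi := implyP (Hx i) i0; have /eqP yi := implyP (Hy i) i0.
by rewrite !mxE xi yi subr0.
Qed.

Lemma addrr_F2n n (x : F2n n) : x + x = 0.
Proof.
apply/rowP=> i; rewrite !mxE -mulr2n -mulr_natr.
by rewrite pchar_Fp_0 ?mulr0.
Qed.

Theorem proposition4p2 (n k : nat) (hn : (2 <= n)%N) (A : {set F2n n})
    (hA : A \subset F2n_pred n :\ 0) (hk : #|A| = k) :
  (exists B : {set F2n n},
     [/\ B \subset [set: F2n n] :\ 0, #|B| = k & rvalue B = rvalue A]) /\
  (exists C : {set F2n n},
     [/\ C \subset [set: F2n n] :\ 0, #|C| = k.+1 & rvalue C = rvalue A]).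
Proof.
move: hA; rewrite subsetD1 => /andP[AH A0].
have n_gt0 : (0 < n)%N := ltnW hn.
pose e : F2n n := delta_mx 0 (Ordinal n_gt0).
have eH : e \notin F2n_pred n.
  by rewrite inE; apply/forallP => /(_ (Ordinal n_gt0)); rewrite mxE !eqxx.
have eA : e \notin A by apply: contra eH; apply: (subsetP AH).
have e0 : e != 0.
  by apply: contraNneq eH => ->; have [] := F2n_pred_zmod_closed n.
split; first by exists A; split; rewrite // subsetD1 subsetT.
exists (e |: A); split.
- by rewrite subsetD1 subsetT !inE negb_or eq_sym e0.
- by rewrite cardsU1 eA hk.
- by apply: (rvalue_setU1 (F2n_pred_zmod_closed n)); rewrite ?addrr_F2n.
Qed.
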